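(* Consider a mirror system of four particles (as defined in the context) with $\Delta=\mathcal{E}^2-\mu<0$. Then its solutions are bounded, i.e. for every solution the positions $x_1,\dots,x_4$ remain in a bounded subset of $\mathbb{R}$. Let $\theta$ be the real angle defined by $e^{i\theta}=\lambda=\sigma_{at}/\sigma_{re}$. If in addition $\theta=\frac{a}{b}\,2\pi$ with $a,b$ coprime positive integers, then every solution is periodic in time with period $$T=\frac{2kb\mu}{\mu-\mathcal{E}^2},\qquad\text{where } k=\frac{x_1^0E_2^0}{\sigma_1^0}.$$
   Context: Units are such that the speed of light is $1$. A particle on the real line has energy $E\in\mathbb{R}\setminus\{0\}$, momentum $P\in\mathbb{R}$, velocity $v=P/E$ and squared mass $E^2-P^2$; energies may have either sign. For each particle put $\sigma=E+P$ and $\rho=E-P$. Between collisions particles move with constant velocity. When particles $i,j$ with $v_i\ne v_j$ collide, put $s=\sigma_i+\sigma_j$, $r=\rho_i+\rho_j$; provided $sr\neq0$, the post-collision values are $\sigma_i'=\rho_i s/r$, $\rho_i'=\sigma_i r/s$, $\sigma_j'=\rho_j s/r$, $\rho_j'=\sigma_j r/s$ (total energy, total momentum and each squared mass are preserved). A mirror system consists of four particles with positions $x_1\le x_2\le x_3\le x_4$ such that at all times $x_1=-x_4$, $x_2=-x_3$, $E_1=E_4$, $P_1=-P_4$, $E_2=E_3$, $P_2=-P_3$; the squared masses are $\mu_1=\mu_4=\mu>0$ and $\mu_2=\mu_3=0$. Collisions of the pair 1-2 are simultaneous with those of the pair 3-4; particles 2 and 3 collide only at the origin, where they exchange their energies and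 momenta (so $E_2$ is unchanged and $P_2$ changes sign). The quantity $\mathcal{E}=E_1+E_2$ is a constant of the motion, and $\Delta=\mathcal{E}^2-\mu$. Solutions are assumed to be such that every collision, in the future and in the past, can be resolved by the collision rule $\sigma_i'=\rho_i s/r$, $\rho_i'=\sigma_i r/s$, $\sigma_j'=\rho_j s/r$, $\rho_j'=\sigma_j r/s$ ($sr\ne0$), and there are no multiple collisions at the same time and point (in particular $x_1<0$). The collisions between particles 1 and 2 (equivalently 3 and 4) are indexed in time order by $n\in\mathbb{Z}$: $x_j^n$ is the position of particle $j$ at the $n$-th such collision; $E_j^n$, $P_j^n$ and $\sigma_j^n=E_j^n+P_j^n$ are the values for particle $j$ between the $n$-th and the $(n+1)$-th such collisions ($P_1$, and hence $\sigma_1$, and $E_2$ are constant there). The map $f(\sigma)=\mu/(2\mathcal{E}-\sigma)$ has, when $\Delta<0$, the two non-real fixed points $\sigma_{at}=\mathcal{E}-\sqrt{\Delta}$ and $\sigma_{re}=\mathcal{E}+\sqrt{\Delta}$, where $\sqrt{\Delta}$ is a fixed complex square root of $\Delta$; they are complex conjugate, so $\lambda=\sigma_{at}/\sigma_{re}$ has $|\lambda|=1$. A solution is periodic with period $T$ if positions, energies and momenta of all particles are periodic functions of time with period $T$. *)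

(* Defs.v *)
From HB Require Import structures.
From mathcomp Require Import all_boot all_order all_algebra.
From mathcomp Require Import complex.
From mathcomp Require Import all_classical all_reals all_analysis.

Set Implicit Arguments.
Unset Strict Implicit.
Unset Printing Implicit Defensive.

Import Order.TTheory GRing.Theory Num.Theory.
Import numFieldNormedType.Exports.

Local Open Scope classical_set_scope.
Local Open Scope ring_scope.

(* Energies and momenta are recorded right-continuously: at a collision instant
   [en] and [mom] are the post-collision values, and [en_in], [mom_in] below are
   the pre-collision ones. *)
Record history (R : Type) (n : nat) := History {
  pos : 'I_n -> R -> R;
  en  : 'I_n -> R -> R;
  mom : 'I_n -> R -> R }.

Section Particles.
Context {R : realType} {n : nat}.
Variable h : history R n.
Implicit Types (i j : 'I_n) (t : R).

Definition vel i t : R := mom h i t / en h i t.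
Definition sigma i t : R := en h i t + mom h i t.
Definition rho i t : R := en h i t - mom h i t.

Definition en_in i t : R := lim (en h i s @[s --> t^'-]).
Definition mom_in i t : R := lim (mom h i s @[s --> t^'-]).
Definition vel_in i t : R := mom_in i t / en_in i t.
Definition sigma_in i t : R := en_in i t + mom_in i t.
Definition rho_in i t : R := en_in i t - mom_in i t.

(* The condition on velocities also rules out [i = j]. *)
Definition collide i j t : Prop :=
  pos h i t = pos h j t /\ vel_in i t <> vel_in j t.

(* Only the outgoing state of [i] is prescribed; that of [j] is obtained by
   exchanging the roles of [i] and [j]. *)
Definition collision_rule i j t : Prop :=
  let s := sigma_in i t + sigma_in j t in
  let r := rho_in i t + rho_in j t in
  [/\ s * r != 0,
      sigma i t = rho_in i t * s / r &
      rho i t = sigma_in i t * r / s].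

(* The fields [motion_before] and [motion_after] make the states locally
   constant off the collisions, and the collision times locally finite. *)
Record solution : Prop := Solution {
  en_neq0 : forall i t, en h i t != 0;
  motion_before : forall i t, \forall s \near t^'-,
    [/\ en h i s = en_in i t,
        mom h i s = mom_in i t &
        pos h i s = pos h i t + vel_in i t * (s - t)];
  motion_after : forall i t, \forall s \near t^'+,
    [/\ en h i s = en h i t,
        mom h i s = mom h i t &
        pos h i s = pos h i t + vel i t * (s - t)];
  no_collision : forall i t, (forall j, ~ collide i j t) ->
    en h i t = en_in i t /\ mom h i t = mom_in i t;
  collision : forall i j t, collide i j t -> collision_rule i j t;
  no_multiple_collision : forall i j k t,
    collide i j t -> collide i k t -> j = k }.

End Particles.

Definition particle1 : 'I_4 := @Ordinal 4 0 isT.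
Definition particle2 : 'I_4 := @Ordinal 4 1 isT.

Section Mirror.
Context {R : realType}.
Implicit Types (h : history R 4) (mu calE : R).

(* [rev_ord] exchanges particles 1 and 4, and particles 2 and 3. *)
Record mirror_solution mu h : Prop := MirrorSolution {
  mirror_sol : solution h;
  mirror_order : forall (i j : 'I_4) t, (i <= j)%N -> pos h i t <= pos h j t;
  mirror_pos : forall i t, pos h (rev_ord i) t = - pos h i t;
  mirror_en : forall i t, en h (rev_ord i) t = en h i t;
  mirror_mom : forall i t, mom h (rev_ord i) t = - mom h i t;
  mirror_mass1 : forall t, en h particle1 t ^+ 2 - mom h particle1 t ^+ 2 = mu;
  mirror_mass2 : forall t, en h particle2 t ^+ 2 - mom h particle2 t ^+ 2 = 0 }.

(* E_1 + E_2 is conserved along a mirror solution, so evaluating it at time 0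
   loses nothing. *)
Definition mirror_energy h : R := en h particle1 0 + en h particle2 0.

Definition Delta mu calE : R := calE ^+ 2 - mu.

(* The two fixed points of [fun s => mu / (2 * calE - s)], where [d] stands for
   the chosen complex square root of [Delta mu calE]. *)
Definition sigma_at calE (d : R[i]) : R[i] := (calE%:C)%C - d.
Definition sigma_re calE (d : R[i]) : R[i] := (calE%:C)%C + d.

Definition expi (theta : R) : R[i] := (cos theta +i* sin theta)%C.

(* [tau m] is the time of the collision of particles 1 and 2 with index [m];
   by right-continuity, [en], [mom] and [sigma] at [tau m] are the values just
   after that collision. *)
Definition collision_times12 h (tau : int -> R) : Prop :=
  {homo tau : m m' / m < m'} /\
  range tau = [set t | collide h particle1 particle2 t].

End Mirror.

(* Main.v *)
(* Both E1 + E2 and Q = E1 E2 x1 - P1 P2 x2 are constants of the motion. Since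
   |E1| >= sqrt mu > |E1 + E2|, the energy E2 stays comparable to E1, so constancy
   of Q bounds x1, and |x2| <= |x1|.
   Between two successive 1-2 collisions v2 x2 - t is constant even across the
   reflection of particle 2 at the origin, which gives the motion explicitly. The
   elapsed time is - x1^n - x1^(n+1), sigma1 evolves by the Moebius map
   f(s) = mu / (2 calE - s), and Q makes x1^n a function of sigma1^n. In the
   coordinate w = (s - s_at) / (s - s_re) the map f is multiplication by lambda
   and x1^n is affine in w and 1/w; over b steps both oscillating terms sum to 0
   and the constant term gives the period. *)
Require Import Defs.
From HB Require Import structures.
From mathcomp Require Import all_boot all_order all_algebra.
From mathcomp Require Import complex.
From mathcomp Require Import all_classical all_reals all_analysis.
From mathcomp Require Import ring lra.

Import Order.TTheory GRing.Theory Num.Theory.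
Import numFieldNormedType.Exports.

Local Open Scope classical_set_scope.
Local Open Scope ring_scope.

(** * Elliptic Moebius orbits and the sum of the collision positions along one cycle *)

Section EllipticOrbit.

(** The recursion is that of the Moebius map with fixed points [p] and [q]. With
    [w = (s - p) / (s - q)] it reads [w' = (p / q) * w], and the summand becomes [(p^2 / w + q^2 * w
    - 2 * p * q) / (p - q)^2]. The first two terms run through geometric progressions whose ratio is
    a nontrivial [b]-th root of unity, so only the constant survives. *)
Lemma moebius_orbit_sum (F : fieldType) (p q : F) (s : nat -> F) (b : nat) :
    p != q -> p != 0 -> q != 0 -> (forall m, s m != p) -> (forall m, s m != q) ->
    (forall m, s m.+1 * (p + q - s m) = p * q) -> (p / q) ^+ b = 1 ->
  s b = s 0%N /\
  \sum_(m < b) s m ^+ 2 / ((s m - p) * (s m - q)) = - (2 * p * q / (p - q) ^+ 2) *+ b.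
Proof.
move=> pq p0 q0 sp sq sS lb; set l := p / q in lb.
have pq0 : p - q != 0 by rewrite subr_eq0.
have sp0 m : s m - p != 0 by rewrite subr_eq0.
have sq0 m : s m - q != 0 by rewrite subr_eq0.
have l1 : l != 1.
  by apply: contraNneq pq => /(canRL (divfK q0)); rewrite mul1r => ->.
have l0 : l != 0 by rewrite mulf_neq0 ?invr_eq0.
pose w m := (s m - p) / (s m - q).
have w0 m : w m != 0 by rewrite mulf_neq0 ?invr_eq0.
have wS m : w m.+1 = l * w m.
  have r0 : p + q - s m != 0.
    by apply/eqP => r0; have /eqP := sS m; rewrite r0 mulr0 eq_sym mulf_eq0 (negPf p0) (negPf q0).
  have sE : s m.+1 = p * q / (p + q - s m) by rewrite -(sS m) mulfK.
  have spE : s m.+1 - p = p * (s m - p) / (p + q - s m) by rewrite sE; field.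
  have sqE : s m.+1 - q = q * (s m - q) / (p + q - s m) by rewrite sE; field.
  have sq0' : p - s m + q != 0 by rewrite addrAC.
  by rewrite /w spE sqE /l; field; rewrite r0 q0 sq0.
have wE m : w m = l ^+ m * w 0%N.
  by elim: m => [|m IH]; rewrite ?mul1r // wS IH exprS mulrA.
have sum0 (k : F) : k != 1 -> k ^+ b = 1 -> \sum_(m < b) k ^+ m = 0.
  move=> k1 kb; apply/eqP; have /eqP := subrX1 k b.
  by rewrite kb subrr eq_sym mulf_eq0 subr_eq0 (negPf k1).
split.
  (* [w] never takes the value 1, the image of infinity, so [s] can be recovered from [w]. *)
  have w1 m : 1 - w m != 0.
    have -> : 1 - w m = (p - q) / (s m - q) by rewrite /w; field.
    by rewrite mulf_neq0 ?invr_eq0.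
  have sE m : s m = (p - w m * q) / (1 - w m).
    by apply: (canRL (mulfK (w1 m))); rewrite /w; field.
  by rewrite sE wE lb mul1r -sE.
have termE m : s m ^+ 2 / ((s m - p) * (s m - q)) =
    (p ^+ 2 / w 0%N * l^-1 ^+ m + q ^+ 2 * w 0%N * l ^+ m) / (p - q) ^+ 2
    - 2 * p * q / (p - q) ^+ 2.
  have -> : p ^+ 2 / w 0%N * l^-1 ^+ m = p ^+ 2 / w m.
    by rewrite [w m]wE exprVn; field; rewrite w0 expf_neq0.
  have -> : q ^+ 2 * w 0%N * l ^+ m = q ^+ 2 * w m by rewrite [w m]wE; ring.
  by rewrite /w; field; rewrite pq0 sp0 sq0.
under eq_bigr do rewrite termE.
rewrite sumrB sumr_const card_ord -mulr_suml big_split /= -!mulr_sumr !sum0 //.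
- by rewrite !mulr0 addr0 mul0r add0r mulNrn.
- by rewrite invr_eq1.
- by rewrite exprVn lb invr1.
Qed.

Context {R : realType}.
Local Notation RC := (real_complex R).

Lemma expiX (t : R) n : expi t ^+ n = expi (t *+ n).
Proof.
elim: n => [|n IH]; first by rewrite expr0 mulr0n /expi cos0 sin0.
by rewrite exprS IH mulrS /expi cosD sinD; simpc; congr (_ +i* _)%C; ring.
Qed.

Lemma expi2pi n : expi (2 * pi *+ n : R) = 1.
Proof.
rewrite -expiX mulr_natl.
by rewrite /expi cos2pi sin2pi expr1n.
Qed.

(** The real orbit is embedded in [R[i]], where the fixed points satisfy [p + q = 2 * calE],
    [p * q = mu] and [(p - q)^2 = 4 * Delta]. The quadratic factor in the hypothesis on [x] is then
    [(s - p) * (s - q)], so [x m] is [c] times the summand of [moebius_orbit_sum]. *)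
Lemma elliptic_orbit_sum (mu calE c theta : R) (d : R[i]) (a b : nat)
    (s x : nat -> R) :
    Delta mu calE < 0 -> 0 < mu -> d ^+ 2 = ((Delta mu calE)%:C)%C ->
    expi theta = sigma_at calE d / sigma_re calE d ->
    (0 < b)%N -> theta = a%:R / b%:R * (2 * pi) ->
    (forall m, s m.+1 * (2 * calE - s m) = mu) ->
    (forall m, x m * (s m ^+ 2 - 2 * calE * s m + mu) = c * s m ^+ 2) ->
  s b = s 0%N /\ \sum_(m < b) x m = - (c * mu * b%:R) / (2 * Delta mu calE).
Proof.
move=> D0 mu0 d2 lE b0 thetaE sS xE.
pose p := sigma_at calE d; pose q := sigma_re calE d.
have pDq : p + q = RC (2 * calE).
  by rewrite rmorphM rmorph_nat /p /q /sigma_at /sigma_re; ring.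
have pMq : p * q = RC mu.
  have -> : p * q = RC calE ^+ 2 - d ^+ 2.
    by rewrite /p /q /sigma_at /sigma_re; ring.
  by rewrite d2 -rmorphXn -rmorphB; congr RC; rewrite /Delta; ring.
have pBq : (p - q) ^+ 2 = RC (4 * Delta mu calE).
  by rewrite rmorphM rmorph_nat /= -d2 /p /q /sigma_at /sigma_re; ring.
have den m : (RC (s m) - p) * (RC (s m) - q) = RC (s m ^+ 2 - 2 * calE * s m + mu).
  by rewrite rmorphD rmorphB rmorphXn [X in _ = _ - X + _]rmorphM /= -pMq -pDq; ring.
(* Completing the square, [Delta < 0] makes the quadratic positive on the reals; hence a real orbit
   avoids both fixed points. *)
have den0 m : s m ^+ 2 - 2 * calE * s m + mu != 0.
  have -> : s m ^+ 2 - 2 * calE * s m + mu = (s m - calE) ^+ 2 - Delta mu calE.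
    by rewrite /Delta; ring.
  by have := sqr_ge0 (s m - calE); lra.
have RC0 (y : R) : y != 0 -> RC y != 0 by rewrite fmorph_eq0.
have spq m : (RC (s m) != p) && (RC (s m) != q).
  by rewrite -[_ == p]subr_eq0 -[_ == q]subr_eq0 -negb_or -mulf_eq0 den RC0.
have pq : p != q.
  by rewrite -subr_eq0 -sqrf_eq0 pBq RC0 // mulf_neq0 ?pnatr_eq0 // lt_eqF.
have /andP[p0 q0] : (p != 0) && (q != 0).
  by rewrite -negb_or -mulf_eq0 pMq RC0 // gt_eqF.
have lb : (p / q) ^+ b = 1.
  rewrite -lE expiX -(expi2pi a) thetaE; congr expi.
  by rewrite -[LHS]mulr_natr -[RHS]mulr_natl; field; rewrite pnatr_eq0 -lt0n.
have [m|m|m|sb sumE] := moebius_orbit_sum _ p q (RC \o s) b pq p0 q0 _ _ _ lb.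
- by case/andP: (spq m).
- by case/andP: (spq m).
- by rewrite /= pDq -rmorphB -rmorphM sS.
split; first exact: complexI sb.
apply: complexI; rewrite rmorph_sum /=.
have xmE m : RC (x m) = RC c * (RC (s m) ^+ 2 / ((RC (s m) - p) * (RC (s m) - q))).
  by rewrite den -rmorphXn -fmorphV -!rmorphM mulrA -xE mulfK.
under eq_bigr do rewrite xmE.
rewrite -mulr_sumr; move: sumE => /= ->.
have -> : 2 * p * q = RC (2 * mu) by rewrite -mulrA pMq rmorphM rmorph_nat.
rewrite pBq -fmorphV -rmorphM -rmorphN -rmorphMn -rmorphM.
by congr RC; rewrite -mulr_natr; field; rewrite lt_eqF.
Qed.

End EllipticOrbit.

(** * Propagation of local constancy along the time axis *)

Section LocallyConstant.
Context {R : realType}.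
Implicit Types (P : R -> Prop) (g : R -> R) (a b t : R).

Lemma near_rightE P t : (\forall s \near t^'+, P s) ->
  exists2 e, 0 < e & forall s, t < s < t + e -> P s.
Proof.
move=> [e /= e0 H]; exists e => // s /andP[ts se].
by apply: H => //=; rewrite ltr_norml; lra.
Qed.

Lemma near_leftE P t : (\forall s \near t^'-, P s) ->
  exists2 e, 0 < e & forall s, t - e < s < t -> P s.
Proof.
move=> [e /= e0 H]; exists e => // s /andP[ts se].
by apply: H => //=; rewrite ltr_norml; lra.
Qed.

(** Supremum argument. Nothing is asked to the left of [a], because at a collision time the recorded
    state agrees with later states but in general not with earlier ones. *)
Lemma locally_constant_itv g a b :
    (forall t, a <= t < b -> \forall s \near t^'+, g s = g t) ->
    (forall t, a < t < b -> \forall s \near t^'-, g s = g t) ->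
  forall t, a <= t < b -> g t = g a.
Proof.
move=> gr gl t /andP[at_ tb].
pose S := [set s | a <= s <= t /\ forall u, a <= u <= s -> g u = g a].
have Sa : S a.
  split; first by rewrite lexx.
  by move=> u; rewrite -eq_le => /eqP ->.
have ubS : ubound S t by move=> s [/andP[]].
pose c := sup S.
have ac : a <= c by apply: ub_le_sup => //; exists t.
have ct : c <= t by apply: ge_sup => //; exists a.
have gc u : a <= u < c -> g u = g a.
  move=> /andP[au uc].
  have [s [_ Ss] us] := sup_gt (ex_intro _ a Sa) uc.
  by apply: Ss; rewrite au ltW.
have gca : g c = g a.
  have [->//|anc] := eqVneq c a.
  have acb : a < c < b by lra.
  have [e e0 He] := near_leftE _ _ (gl c acb).
  pose u := Num.max ((a + c) / 2) (c - e / 2).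
  have u1 : (a + c) / 2 <= u by rewrite le_max lexx.
  have u2 : c - e / 2 <= u by rewrite le_max lexx orbT.
  have u3 : u < c by rewrite gt_max; lra.
  by rewrite -(He u) ?gc //; lra.
have [->//|cnt] := eqVneq t c.
have acb : a <= c < b by lra.
have [e e0 He] := near_rightE _ _ (gr c acb).
(* Constancy to the right of [c] carries the set [S] past its supremum, a contradiction. *)
pose u := Num.min t (c + e / 2).
have u1 : u <= t by rewrite ge_min lexx.
have u2 : u <= c + e / 2 by rewrite ge_min lexx orbT.
have u3 : c < u by rewrite lt_min; lra.
suff /(ub_le_sup (ex_intro _ t ubS)) : S u by rewrite -/c; lra.
split; first by lra.
move=> v /andP[av vu].
have [vc|vc|->//] := ltgtP v c; first by apply: gc; lra.
by rewrite He ?gca //; lra.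
Qed.

Lemma locally_constant g :
    (forall t, \forall s \near t^'+, g s = g t) ->
    (forall t, \forall s \near t^'-, g s = g t) ->
  forall a t, g t = g a.
Proof.
move=> gr gl a t; wlog at_ : a t / a <= t.
  by move=> H; case: (leP a t) => [/H//|/ltW/H ->].
by apply: (locally_constant_itv g a (t + 1)) => //; lra.
Qed.

End LocallyConstant.

(** * Velocities of massive and massless particles, and the inequality behind boundedness *)

Section Kinematics.
Context {R : realFieldType}.
Implicit Types e p m : R.

Lemma massive_vel_lt1 e p m : e != 0 -> 0 < m -> e ^+ 2 - p ^+ 2 = m ->
  -1 < p / e < 1.
Proof.
move=> e0 m0 em.
have : (p / e) ^+ 2 < 1.
  by rewrite expr_div_n ltr_pdivrMr ?exprn_even_gt0 //; lra.
by move=> pe1; apply/andP; split; nra.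
Qed.

Lemma massless_mom e p : e ^+ 2 - p ^+ 2 = 0 -> p = e \/ p = - e.
Proof. by move=> /eqP; rewrite subr_eq0 eq_sym eqf_sqr => /orP[]/eqP; auto. Qed.

Lemma massless_vel e p : e != 0 -> e ^+ 2 - p ^+ 2 = 0 ->
  p / e = 1 \/ p / e = -1.
Proof. by move=> e0 /massless_mom[]->; rewrite ?mulNr divff //; auto. Qed.

(* Here [A - B = m ^+ 2 / (A + B)], and [F] is at least a fixed multiple of [A]. *)
Lemma kinetic_bound (A B F Q X m c : R) :
    0 <= A -> 0 <= B -> 0 <= F -> 0 <= X -> 0 <= c -> c < m ->
    A ^+ 2 - B ^+ 2 = m ^+ 2 -> A - F <= c -> A * F * X - B * F * X <= Q ->
  X * ((m - c) * m ^+ 2) <= 2 * m * Q.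
Proof.
move=> A0 B0 F0 X0 c0 cm AB2 FA Q1.
have m0 : 0 < m by lra.
have m20 : 0 < m ^+ 2 by rewrite exprn_gt0.
have AB : B < A by rewrite -ltr_sqr ?nnegrE //; lra.
have mA : m <= A.
  by rewrite -ler_sqr ?nnegrE ?(ltW m0) //; have := sqr_ge0 B; lra.
have ABm : m ^+ 2 <= (A - B) * (2 * A).
  have -> : m ^+ 2 = (A - B) * (A + B) by rewrite -AB2; ring.
  by rewrite ler_wpM2l; lra.
(* The fixed multiple is [(m - c) / m]: since [m <= A], one has
   [A * (m - c) <= (A - c) * m <= F * m]. *)
have FAm : A * (m - c) <= F * m.
  have : (A - c) * m <= F * m by rewrite ler_wpM2r ?(ltW m0) //; lra.
  have : c * m <= c * A by rewrite ler_wpM2l.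
  lra.
have : X * ((m - c) * m ^+ 2) <= X * ((m - c) * ((A - B) * (2 * A))).
  by rewrite !ler_wpM2l //; lra.
move=> /le_trans; apply.
have : X * (A - B) * 2 * (A * (m - c)) <= X * (A - B) * 2 * (F * m).
  by rewrite ler_wpM2l // !mulr_ge0 //; lra.
have : 2 * m * (A * F * X - B * F * X) <= 2 * m * Q by rewrite ler_wpM2l //; lra.
lra.
Qed.

End Kinematics.

(** * Mirror solutions: incoming states, contacts and the effect of each collision *)

Section MirrorSolution.
Context {R : realType} {mu : R} {h : history R 4}.
Hypotheses (mu_gt0 : 0 < mu) (hm : mirror_solution mu h).

Local Notation x1 := (pos h particle1).
Local Notation x2 := (pos h particle2).
Local Notation E1 := (en h particle1).
Local Notation E2 := (en h particle2).
Local Notation P1 := (mom h particle1).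
Local Notation P2 := (mom h particle2).
Local Notation v1 := (vel h particle1).
Local Notation v2 := (vel h particle2).
Local Notation E1in := (en_in h particle1).
Local Notation E2in := (en_in h particle2).
Local Notation P1in := (mom_in h particle1).
Local Notation P2in := (mom_in h particle2).

Let hs := mirror_sol hm.

Lemma near_left12 t : \forall s \near t^'-,
  [/\ E1 s = E1in t, P1 s = P1in t & x1 s = x1 t + vel_in h particle1 t * (s - t)] /\
  [/\ E2 s = E2in t, P2 s = P2in t & x2 s = x2 t + vel_in h particle2 t * (s - t)].
Proof. by apply: filterI; exact: motion_before hs _ t. Qed.

Lemma near_right12 t : \forall s \near t^'+,
  [/\ E1 s = E1 t, P1 s = P1 t & x1 s = x1 t + v1 t * (s - t)] /\
  [/\ E2 s = E2 t, P2 s = P2 t & x2 s = x2 t + v2 t * (s - t)].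
Proof. by apply: filterI; exact: motion_after hs _ t. Qed.

(** Incoming states are limits, but they are attained at some earlier instant; mass shells, mirror
    symmetry and nonvanishing of energies thereby pass to them. *)
Lemma in_state_attained i t : exists s,
  [/\ en_in h i t = en h i s, mom_in h i t = mom h i s,
      en_in h (rev_ord i) t = en h i s & mom_in h (rev_ord i) t = - mom h i s].
Proof.
have := @filterI _ _ (at_left_proper_filter t) _ _ (motion_before hs i t)
  (motion_before hs (rev_ord i) t).
move=> /filter_ex[s [[<- <- _] [<- <- _]]]; exists s.
by split => //; rewrite ?(mirror_en hm) ?(mirror_mom hm).
Qed.

Lemma en_in_rev i t : en_in h (rev_ord i) t = en_in h i t.
Proof. by have [s [-> _ ->]] := in_state_attained i t. Qed.

Lemma mom_in_rev i t : mom_in h (rev_ord i) t = - mom_in h i t.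
Proof. by have [s [_ -> _ ->]] := in_state_attained i t. Qed.

Lemma en_in_neq0 i t : en_in h i t != 0.
Proof. by have [s [-> _ _ _]] := in_state_attained i t; exact: en_neq0 hs i s. Qed.

Lemma mass1_in t : E1in t ^+ 2 - P1in t ^+ 2 = mu.
Proof.
have [s [-> -> _ _]] := in_state_attained particle1 t.
exact: mirror_mass1 hm s.
Qed.

Lemma mass2_in t : E2in t ^+ 2 - P2in t ^+ 2 = 0.
Proof.
have [s [-> -> _ _]] := in_state_attained particle2 t.
exact: mirror_mass2 hm s.
Qed.

Lemma vel1_in_lt1 t : -1 < vel_in h particle1 t < 1.
Proof. exact: massive_vel_lt1 (en_in_neq0 _ t) mu_gt0 (mass1_in t). Qed.

Lemma vel2E t : v2 t = 1 \/ v2 t = -1.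
Proof. exact: massless_vel (en_neq0 hs _ t) (mirror_mass2 hm t). Qed.

Lemma vel2_inE t : vel_in h particle2 t = 1 \/ vel_in h particle2 t = -1.
Proof. exact: massless_vel (en_in_neq0 _ t) (mass2_in t). Qed.

Lemma vel_in_rev i t : vel_in h (rev_ord i) t = - vel_in h i t.
Proof. by rewrite /vel_in en_in_rev mom_in_rev mulNr. Qed.

Lemma pos12 t : x1 t <= x2 t <= 0.
Proof.
rewrite (mirror_order hm) //=.
by have := mirror_order hm (i := particle2) (j := rev_ord particle2) t erefl;
  rewrite (mirror_pos hm); lra.
Qed.

(** Particle 1 is slower than light and particle 2 moves at light speed, so on contact their
    incoming velocities differ automatically. *)
Lemma collide12 t : collide h particle1 particle2 t <-> x1 t = x2 t.
Proof.
split=> [[]//|x12]; split => // v12; have := vel1_in_lt1 t; rewrite v12.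
by case: (vel2_inE t) => ->; lra.
Qed.

Lemma collide13 t : x1 t = 0 -> collide h particle1 (rev_ord particle2) t.
Proof.
move=> x10; split; first by rewrite (mirror_pos hm); have := pos12 t; lra.
move=> v13; have := vel1_in_lt1 t; rewrite v13 vel_in_rev.
by case: (vel2_inE t) => ->; lra.
Qed.

(** If [x1] vanished, all particles would sit at the origin and particle 1 would collide with both 2
    and 3, which is forbidden. *)
Lemma pos1_lt0 t : x1 t < 0.
Proof.
have x120 := pos12 t.
have [->//|x1n0] : x1 t < 0 \/ x1 t = 0 by lra.
have c12 : collide h particle1 particle2 t by apply/collide12; lra.
by have /(congr1 val) := no_multiple_collision hs c12 (collide13 _ x1n0).
Qed.

Lemma no_collision1 t : x1 t < x2 t -> E1 t = E1in t /\ P1 t = P1in t.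
Proof.
move=> x12; apply: (no_collision hs) => j [x1j v1j].
have [j0|j0] := posnP (val j).
  by apply: v1j; congr (vel_in h _ t); apply: val_inj.
by have := mirror_order hm (i := particle2) t j0; lra.
Qed.

Lemma no_collision2 t : x1 t < x2 t < 0 -> E2 t = E2in t /\ P2 t = P2in t.
Proof.
move=> x120; apply: (no_collision hs) => j [x2j v2j].
have [j0|j0] := posnP (val j).
  suff jE : j = particle1 by move: x2j; rewrite jE; lra.
  exact: val_inj.
have [j1|j1] := ltnP 1 (val j).
  have := mirror_order hm (i := rev_ord particle2) t j1.
  by rewrite (mirror_pos hm); lra.
by apply: v2j; congr (vel_in h _ t); apply: val_inj => /=; apply/eqP; rewrite eqn_leq j0 j1.
Qed.

(** By symmetry both sums [s] and [r] in the rule equal [2 * E2in t], so the rule merely exchanges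
    [sigma] and [rho] of particle 2. *)
Lemma collision23 t : x2 t = 0 -> E2 t = E2in t /\ P2 t = - P2in t.
Proof.
move=> x20; have e0 := en_in_neq0 particle2 t.
have /(collision hs)[_] : collide h particle2 (rev_ord particle2) t.
  split; first by rewrite (mirror_pos hm) x20 oppr0.
  by rewrite vel_in_rev; case: (vel2_inE t) => ->; lra.
rewrite /sigma_in /rho_in en_in_rev mom_in_rev /sigma /rho.
have -> : E2in t + P2in t + (E2in t + - P2in t) = 2 * E2in t by ring.
have -> : E2in t - P2in t + (E2in t - - P2in t) = 2 * E2in t by ring.
by rewrite !mulfK ?mulf_neq0 ?pnatr_eq0 //; lra.
Qed.

(** A right-moving particle 2 would outrun particle 1, hence would have been to its left just before
    contact, against the ordering. *)
Lemma approach12 t : x1 t = x2 t -> P2in t = - E2in t.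
Proof.
move=> x12.
have [e e0 /(_ (t - e / 2))] := near_leftE _ _ (near_left12 t).
case=> [|[_ _ x1s] [_ _ x2s]]; first by lra.
have := pos12 (t - e / 2); rewrite x1s x2s x12.
have -> : t - e / 2 - t = - (e / 2) by ring.
have := vel1_in_lt1 t.
case: (massless_mom _ _ (mass2_in t)) => // P2E.
have -> : vel_in h particle2 t = 1 by rewrite /vel_in P2E divff // en_in_neq0.
by nra.
Qed.

(* As [sigma2] vanishes before the collision, [s] and [r] are the sums denoted so
   in the collision rule. *)
Lemma collision12 t : x1 t = x2 t ->
  let s := sigma_in h particle1 t in
  let r := 2 * (E1in t + E2in t) - s in
  [/\ s * r != 0, sigma h particle1 t = mu / r,
      E1 t + E2 t = E1in t + E2in t, E2 t = E2in t * s / r & P2 t = E2 t].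
Proof.
move=> x12 s r; have P2E := approach12 _ x12.
have c12 : collide h particle1 particle2 t by apply/collide12.
have c21 : collide h particle2 particle1 t by case: c12 => _ /nesym.
have [sr0 s1 r1] := collision hs c12; have [_ s2 r2] := collision hs c21.
have sE : sigma_in h particle1 t + sigma_in h particle2 t = s.
  by rewrite /s /sigma_in P2E; ring.
have rE : rho_in h particle1 t + rho_in h particle2 t = r.
  by rewrite /r /s /rho_in /sigma_in P2E; ring.
rewrite [sigma_in _ _ _ + _]addrC [rho_in _ _ _ + _]addrC sE rE in s2 r2.
rewrite sE rE in sr0 s1 r1.
have /andP[s0 r0] : (s != 0) && (r != 0) by rewrite -negb_or -mulf_eq0.
have mE : rho_in h particle1 t * s = mu by rewrite -(mass1_in t) /s /rho_in /sigma_in; ring.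
have s2E : sigma_in h particle2 t = 0 by rewrite /sigma_in P2E; ring.
have r2E : rho_in h particle2 t = 2 * E2in t by rewrite /rho_in P2E; ring.
have r0E : rho h particle2 t = 0 by rewrite r2 s2E !mul0r.
split => //.
- by rewrite s1 mE.
(* The left side is twice the outgoing total energy, and [s + r] is twice the incoming one. *)
- suff : sigma h particle1 t + rho h particle1 t + (sigma h particle2 t + rho h particle2 t)
    = s + r.
    by rewrite /sigma /rho /r; lra.
  rewrite s1 r1 s2 r2 -/s s2E.
  by rewrite mul0r mul0r addr0 addrAC -!mulrDl rE mulrAC divff // mul1r mulrAC divff // mul1r.
- by move: s2 r0E; rewrite r2E /sigma /rho -!mulrA; move: (E2in t * _) => q; lra.
- by move: r0E; rewrite /rho; lra.
Qed.

(** * The two constants of the motion *)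

Lemma energy12_in t : E1in t + E2in t = E1 t + E2 t.
Proof.
have x120 := pos12 t.
have [x12|x12] : x1 t = x2 t \/ x1 t < x2 t by lra.
  by have [_ _ -> _ _] := collision12 _ x12.
have [-> _] := no_collision1 _ x12.
have [x20|x20] : x2 t = 0 \/ x2 t < 0 by lra.
  by have [-> _] := collision23 _ x20.
by have [|-> _] := no_collision2 t; first by rewrite x12.
Qed.

Lemma energy12_const t u : E1 t + E2 t = E1 u + E2 u.
Proof.
apply: (locally_constant (fun t => E1 t + E2 t)) => {u} u.
  by apply: filterS (near_right12 u) => s [[-> _ _] [-> _ _]].
by apply: filterS (near_left12 u) => s [[-> _ _] [-> _ _]]; exact: energy12_in.
Qed.

Lemma rho1_collision12 t : x1 t = x2 t ->
  rho h particle1 t = 2 * (E1in t + E2in t) - sigma_in h particle1 t.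
Proof.
move=> /collision12[]; set r := 2 * _ - _.
rewrite mulf_eq0 negb_or => /andP[_ r0] s1 _ _ _.
have srE : sigma h particle1 t * rho h particle1 t = mu.
  by rewrite -(mirror_mass1 hm t) /sigma /rho; ring.
apply: (@mulfI _ (mu / r)); first by rewrite mulf_neq0 ?invr_eq0 // gt_eqF.
by rewrite -[in LHS]s1 srE divfK.
Qed.

(* [mu] times the constant [k] of the theorem: at a 1-2 collision it equals
   [x1 * E2 * rho1 = mu * x1 * E2 / sigma1]. *)
Definition pair_product t := E1 t * E2 t * x1 t - P1 t * P2 t * x2 t.

(** At a 1-2 contact the quantity is [E2in * s * x1] before and [E2 * rho1 * x1] after; these agree
    because [E2 = E2in * s / r] and [rho1 = r]. At the origin the sign change of [P2] is harmless
    since [x2 = 0]. *)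
Lemma pair_product_in t :
  E1in t * E2in t * x1 t - P1in t * P2in t * x2 t = pair_product t.
Proof.
have x120 := pos12 t; rewrite /pair_product.
have [x12|x12] : x1 t = x2 t \/ x1 t < x2 t by lra.
  have [+ _ _ E2E ->] := collision12 _ x12.
  rewrite mulf_eq0 negb_or => /andP[_ r0].
  have := rho1_collision12 _ x12; move: E2E r0; set r := 2 * _ - _.
  move: r => r E2E r0 rE; rewrite -x12 (approach12 _ x12).
  have -> : E1 t * E2 t * x1 t - P1 t * E2 t * x1 t = E2 t * rho h particle1 t * x1 t.
    by rewrite /rho; ring.
  by rewrite E2E rE divfK // /sigma_in; ring.
have [-> ->] := no_collision1 _ x12.
have [x20|x20] : x2 t = 0 \/ x2 t < 0 by lra.
  by have [-> ->] := collision23 _ x20; rewrite x20; ring.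
by have [|-> ->] := no_collision2 t; first by rewrite x12.
Qed.

(** Free motion for a time [d] changes the quantity by [p * d * (f^2 - q^2) / f], which vanishes
    since the second particle is massless. *)
Lemma pair_product_free (e p f q x y d : R) : e != 0 -> f != 0 ->
    f ^+ 2 - q ^+ 2 = 0 ->
  e * f * (x + p / e * d) - p * q * (y + q / f * d) = e * f * x - p * q * y.
Proof.
move=> e0 f0 fq; have -> : e * f * (x + p / e * d) - p * q * (y + q / f * d) =
    e * f * x - p * q * y + p * d * (f ^+ 2 - q ^+ 2) / f.
  by field; rewrite e0 f0.
by rewrite fq mulr0 mul0r addr0.
Qed.

Lemma pair_product_const t u : pair_product t = pair_product u.
Proof.
apply: (locally_constant pair_product) => {u} u.
  apply: filterS (near_right12 u) => s [[E1s P1s x1s] [E2s P2s x2s]].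
  rewrite /pair_product E1s P1s x1s E2s P2s x2s.
  apply: pair_product_free; try exact: en_neq0 hs _ _.
  exact: mirror_mass2 hm u.
apply: filterS (near_left12 u) => s [[E1s P1s x1s] [E2s P2s x2s]].
rewrite -[RHS]pair_product_in /pair_product E1s P1s x1s E2s P2s x2s.
apply: pair_product_free; try exact: en_in_neq0.
exact: mass2_in u.
Qed.

(** * Boundedness of the positions *)

Lemma pos_le_pos1 i t : `|pos h i t| <= - x1 t.
Proof.
rewrite ler_norml opprK (mirror_order hm) //= -(mirror_pos hm).
by apply: (mirror_order hm); rewrite /= -ltnS ltn_ord.
Qed.

Lemma pos1_bound t :
    let c := `|mirror_energy h| in
    c < Num.sqrt mu ->
  - x1 t * ((Num.sqrt mu - c) * mu) <= 2 * Num.sqrt mu * `|pair_product 0|.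
Proof.
move=> c; set m := Num.sqrt mu => cm.
have m2 : m ^+ 2 = mu by rewrite sqr_sqrtr // ltW.
have m0 : 0 < m by rewrite sqrtr_gt0.
have c0 : 0 <= c by exact: normr_ge0.
have m1 := mirror_mass1 hm t.
have fc : `|E1 t| - `|E2 t| <= c.
  rewrite /c /mirror_energy -(energy12_const t 0) -[E2 t]opprK normrN.
  exact: lerB_dist.
have g2 : `|P2 t| = `|E2 t|.
  by case: (massless_mom _ _ (mirror_mass2 hm t)) => -> //; rewrite normrN.
(* Reverse triangle inequality applied to [pair_product t], with [|P2| = |E2|] and [|x2| <= |x1|];
   this is the last hypothesis of [kinetic_bound]. *)
have Q1 : `|E1 t| * `|E2 t| * - x1 t - `|P1 t| * `|E2 t| * - x1 t <= `|pair_product 0|.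
  have -> : - x1 t = `|x1 t| by rewrite ltr0_norm // pos1_lt0.
  rewrite (pair_product_const 0 t) /pair_product.
  apply: le_trans (lerB_dist _ _); rewrite !normrM lerD2l lerN2 g2.
  rewrite ler_wpM2l ?mulr_ge0 //.
  by have := pos12 t; move=> /andP[x12 x20]; rewrite !ler0_norm // ?(le_trans x12) // lerN2.
rewrite -(real_normK (num_real (E1 t))) -(real_normK (num_real (P1 t))) in m1.
have A0 := normr_ge0 (E1 t); have B0 := normr_ge0 (P1 t).
have X0 := pos1_lt0 t; have F0 := normr_ge0 (E2 t).
suff : - x1 t * ((m - c) * m ^+ 2) <= 2 * m * `|pair_product 0| by rewrite m2.
apply: kinetic_bound Q1 => //; first by rewrite oppr_ge0 ltW // pos1_lt0.
by rewrite m2.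
Qed.

Lemma mirror_bounded : mirror_energy h ^+ 2 < mu ->
  forall i, bounded_set (range (pos h i)).
Proof.
move=> em i.
have cm : `|mirror_energy h| < Num.sqrt mu.
  by rewrite -sqrtr_sqr ltr_sqrt.
exists (2 * Num.sqrt mu * `|pair_product 0| / ((Num.sqrt mu - `|mirror_energy h|) * mu)).
split; first exact: num_real.
move=> M /ltW CM y [t _ <-] /=; apply: le_trans (pos_le_pos1 i t) _.
apply: le_trans CM; rewrite ler_pdivlMr ?mulr_gt0 ?subr_gt0 //.
exact: pos1_bound.
Qed.

(** * Explicit motion between successive 1-2 collisions *)

Lemma vel2_sqr t : v2 t * v2 t = 1.
Proof. by case: (vel2E t) => ->; ring. Qed.

Lemma vel2_at_origin t : x2 t = 0 -> v2 t = -1.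
Proof.
move=> x20; have [e e0 /(_ (t + e / 2))[|_ [_ _ x2s]]] := near_rightE _ _ (near_right12 t).
  by lra.
have := pos12 (t + e / 2); rewrite x2s x20.
by case: (vel2E t) => // ->; lra.
Qed.

Section BetweenCollisions.
Context {a b : R}.
Hypotheses (x12a : x1 a = x2 a) (free : forall t, a < t < b -> x1 t < x2 t).

Lemma free_energies t : a <= t < b -> [/\ E1 t = E1 a, P1 t = P1 a & E2 t = E2 a].
Proof.
move=> atb; have E1E : E1 t = E1 a.
  apply: (locally_constant_itv E1 a b) => // u aub.
    by apply: filterS (near_right12 u) => s [[]].
  apply: filterS (near_left12 u) => s [[-> _ _] _].
  by have [] := no_collision1 _ (free _ aub).
(* Constancy of [E2] comes from the total energy, which covers a reflection at the origin without a
   case distinction. *)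
split => //; last by have := energy12_const t a; rewrite E1E => /addrI.
apply: (locally_constant_itv P1 a b) => // u aub.
  by apply: filterS (near_right12 u) => s [[]].
apply: filterS (near_left12 u) => s [[_ -> _] _].
by have [] := no_collision1 _ (free _ aub).
Qed.

Lemma free_pos1 t : a <= t < b -> x1 t = x1 a + v1 a * (t - a).
Proof.
move=> atb; suff : x1 t - v1 a * t = x1 a - v1 a * a by lra.
apply: (locally_constant_itv (fun t => x1 t - v1 a * t) a b) => // u aub.
  have [E1u P1u _] := free_energies _ aub.
  apply: filterS (near_right12 u) => s [[_ _ ->] _].
  by rewrite /vel E1u P1u; ring.
have /free_energies[E1u P1u _] : a <= u < b by lra.
apply: filterS (near_left12 u) => s [[_ _ ->] _].
rewrite /vel_in; have [<- <-] := no_collision1 _ (free _ aub).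
by rewrite E1u P1u /vel; ring.
Qed.

(* Reflection at the origin reverses the signs of both [v2] and [x2]. *)
Lemma free_vel2_pos2 t : a <= t < b -> v2 a = 1 -> v2 t * x2 t = x1 a + (t - a).
Proof.
move=> atb v2a; suff : v2 t * x2 t - t = v2 a * x2 a - a by rewrite v2a -x12a; lra.
apply: (locally_constant_itv (fun t => v2 t * x2 t - t) a b) => // u aub.
  apply: filterS (near_right12 u) => s [_ [E2s P2s ->]].
  by rewrite /vel E2s P2s -/(vel h particle2 u) mulrDr mulrA vel2_sqr; ring.
apply: filterS (near_left12 u) => s [_ [E2s P2s ->]].
have vv : vel_in h particle2 u * vel_in h particle2 u = 1.
  by case: (vel2_inE u) => ->; ring.
have -> : v2 s = vel_in h particle2 u by rewrite /vel E2s P2s.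
rewrite mulrDr mulrA vv.
have [x20|x20] : x2 u = 0 \/ x2 u < 0 by have := pos12 u; lra.
  by rewrite x20; ring.
rewrite /vel_in /vel; have [|<- <-] := no_collision2 u; first by rewrite free.
by ring.
Qed.

(** [u] is the position particle 2 would have if it crossed the origin freely; folding it back gives
    the actual motion, and the sign of [u] tells whether the reflection has occurred. *)
Lemma free_state2 t : a <= t < b -> v2 a = 1 ->
  let u := x1 a + (t - a) in
  x2 t = - `|u| /\ P2 t = (if u < 0 then E2 a else - E2 a).
Proof.
move=> atb v2a u; have := free_vel2_pos2 _ atb v2a; rewrite -/u.
have [_ _ <-] := free_energies _ atb.
have -> : P2 t = v2 t * E2 t by rewrite /vel divfK // en_neq0.
have x20 := pos12 t.
case: (vel2E t) => v2t; rewrite v2t ?mul1r ?mulN1r => uE; last first.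
  have u0 : 0 <= u by lra.
  by rewrite ger0_norm // ltNge u0 /= -uE opprK.
(* Strict, because the velocity recorded at the origin is already the reflected one, [-1]. *)
have u0 : u < 0.
  rewrite lt_neqAle -uE; apply/andP; split; last by lra.
  by apply/eqP => /vel2_at_origin; rewrite v2t; lra.
by rewrite u0 ltr0_norm // opprK.
Qed.

Lemma next_collision : a < b -> v2 a = 1 -> x1 b = x2 b ->
  [/\ E1in b = E1 a, P1in b = P1 a, E2in b = E2 a & b - a = - x1 a - x1 b].
Proof.
move=> ab v2a x12b.
have [e e0 He] := near_leftE _ _ (near_left12 b).
(* At an instant [s] between [a] and [b], close enough to [b], both the free motion from [a] and the
   incoming linear motion at [b] are valid; comparing them gives all four equations. *)
pose s := Num.max ((a + b) / 2) (b - e / 2).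
have s1 : (a + b) / 2 <= s by rewrite le_max lexx.
have s2 : b - e / 2 <= s by rewrite le_max lexx orbT.
have sb : s < b by rewrite gt_max; lra.
have asb : a <= s < b by lra.
have [|[E1s P1s x1s] [E2s P2s x2s]] := He s; first by lra.
have [E1a P1a E2a] := free_energies _ asb.
have v1E : vel_in h particle1 b = v1 a by rewrite /vel_in /vel -E1s -P1s E1a P1a.
have v2E : vel_in h particle2 b = -1.
  by rewrite /vel_in (approach12 _ x12b) mulNr divff // en_in_neq0.
have v2s : v2 s = -1 by rewrite /vel E2s P2s.
have := free_pos1 _ asb; have := free_vel2_pos2 _ asb v2a.
rewrite v2s x2s x1s v1E v2E => ? ?.
by split; rewrite -?E1s -?P1s -?E2s //; lra.
Qed.

End BetweenCollisions.

(** * The recursion from one 1-2 collision to the next *)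

Lemma vel2_collision12 t : x1 t = x2 t -> v2 t = 1.
Proof.
by move=> /collision12[_ _ _ _ P2E]; rewrite /vel P2E divff // en_neq0.
Qed.

Lemma sigma1_rho1 t : sigma h particle1 t * rho h particle1 t = mu.
Proof. by rewrite -(mirror_mass1 hm t) /sigma /rho; ring. Qed.

Lemma pair_product_collision12 t : x1 t = x2 t ->
  x1 t * E2 t * rho h particle1 t = pair_product 0.
Proof.
move=> x12; rewrite (pair_product_const 0 t) /pair_product -x12.
by have [_ _ _ _ ->] := collision12 _ x12; rewrite /rho; ring.
Qed.

(** The quadratic equals [-2 * E2 * sigma1], since [sigma1 + rho1 = 2 * E1]; the formula is then the
    constancy of [x1 * E2 * rho1] rewritten with [sigma1 * rho1 = mu]. *)
Lemma pos1_collision12 t : x1 t = x2 t ->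
  x1 t * (sigma h particle1 t ^+ 2 - 2 * mirror_energy h * sigma h particle1 t + mu) =
  - (2 * pair_product 0 / mu) * sigma h particle1 t ^+ 2.
Proof.
move=> x12; rewrite -(pair_product_collision12 _ x12) /mirror_energy -(energy12_const t 0).
rewrite -(sigma1_rho1 t); have : sigma h particle1 t * rho h particle1 t != 0.
  by rewrite sigma1_rho1 gt_eqF.
rewrite mulf_eq0 negb_or => /andP[s0 r0].
have -> : E1 t = (sigma h particle1 t + rho h particle1 t) / 2.
  by rewrite /sigma /rho; field.
by field; rewrite s0 r0.
Qed.

(** At a 1-2 collision [sigma1] determines everything: [rho1] by the mass shell, hence [E1] and
    [P1], then [E2] by the total energy and [x1] by [pair_product]. *)
Lemma collision12_state t u : x1 t = x2 t -> x1 u = x2 u ->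
  sigma h particle1 t = sigma h particle1 u ->
  [/\ E1 t = E1 u, P1 t = P1 u, E2 t = E2 u & x1 t = x1 u].
Proof.
move=> x12t x12u su; have mu0 : mu != 0 by rewrite gt_eqF.
have s0 : sigma h particle1 u != 0.
  by apply: contraNneq mu0 => s0; rewrite -(sigma1_rho1 u) s0 mul0r.
have r0 : rho h particle1 u != 0.
  by apply: contraNneq mu0 => r0; rewrite -(sigma1_rho1 u) r0 mulr0.
have ru : rho h particle1 t = rho h particle1 u.
  by apply: (mulfI s0); rewrite -{1}su !sigma1_rho1.
have [E1u P1u] : E1 t = E1 u /\ P1 t = P1 u by move: su ru; rewrite /sigma /rho; lra.
have E2u : E2 t = E2 u by have := energy12_const t u; rewrite E1u => /addrI.
split => //; have := pair_product_collision12 _ x12t.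
rewrite -(pair_product_collision12 _ x12u) ru E2u => /(mulIf r0)/mulIf; apply.
exact: en_neq0 hs _ _.
Qed.

Lemma sigma1_step a b : x1 a = x2 a -> x1 b = x2 b -> a < b ->
    (forall t, a < t < b -> x1 t < x2 t) ->
  sigma h particle1 b * (2 * mirror_energy h - sigma h particle1 a) = mu.
Proof.
move=> x12a x12b ab free.
have [E1b P1b E2b _] := next_collision x12a free ab (vel2_collision12 _ x12a) x12b.
have [] := collision12 _ x12b; rewrite /sigma_in E1b P1b E2b (energy12_const a 0).
rewrite -/(sigma h particle1 a) -/(mirror_energy h) mulf_eq0 negb_or => /andP[_ r0] -> _ _ _.
by rewrite divfK.
Qed.

(** * The sequence of collision times *)

Section CollisionTimes.
Context {tau : int -> R}.
Hypothesis htau : collision_times12 h tau.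

Lemma tau_collision n : x1 (tau n) = x2 (tau n).
Proof.
have : [set t | collide h particle1 particle2 t] (tau n) by rewrite -htau.2; exists n.
by move=> /collide12.
Qed.

Lemma tau_lt : {mono tau : n m / n < m}.
Proof. exact: leW_mono (le_mono htau.1). Qed.

Lemma tau_free (n : int) t : tau n < t < tau (n + 1) -> x1 t < x2 t.
Proof.
move=> tn; have [x12|//] : x1 t = x2 t \/ x1 t < x2 t by have := pos12 t; lra.
have : range tau t by rewrite htau.2; apply/collide12.
by move=> [m _ mt]; move: tn; rewrite -mt !tau_lt ltzD1 ltNge andNb.
Qed.

Lemma tau_step (n : int) : tau (n + 1) - tau n = - x1 (tau n) - x1 (tau (n + 1)).
Proof.
have x12 := tau_collision n.
have [|_ _ _ ->//] := next_collision x12 (tau_free n) _ (vel2_collision12 _ x12)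
  (tau_collision (n + 1)).
by rewrite tau_lt ltzD1.
Qed.

(** Telescoping [tau_step] counts each interior position twice; the last two terms correct the two
    endpoints. *)
Lemma tau_sum (n : int) (b : nat) :
  tau (n + b%:Z) = tau n - 2 * (\sum_(m < b) x1 (tau (n + m%:Z)))
    + x1 (tau n) - x1 (tau (n + b%:Z)).
Proof.
elim: b => [|b IH]; first by rewrite big_ord0 addr0; ring.
rewrite big_ord_recr /=; have := tau_step (n + b%:Z).
by rewrite (_ : n + b.+1%:Z = n + b%:Z + 1); [lra|rewrite -addn1 PoszD addrA].
Qed.

(** * From a cycle of [sigma1] to periodicity in time *)

Section Period.
Context {b : nat} {T : R}.
Hypotheses (b_gt0 : (0 < b)%N)
  (sigma_b : forall n, sigma h particle1 (tau (n + b%:Z)) = sigma h particle1 (tau n))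
  (tau_b : forall n, tau (n + b%:Z) = tau n + T).

Lemma period_gt0 : 0 < T.
Proof.
have : tau 0 < tau (0 + b%:Z) by rewrite tau_lt add0r.
by rewrite tau_b; lra.
Qed.

Lemma tau_bX n (k : nat) : tau (n + (b * k)%N%:Z) = tau n + T *+ k.
Proof.
elim: k => [|k IH]; first by rewrite muln0 !addr0.
by rewrite mulnS addnC PoszD addrA tau_b IH mulrS; ring.
Qed.

(** Shifting the index by [b] shifts [tau] by [T > 0], so [tau] is unbounded both ways; the first
    index from [n0] on whose successor time exceeds [t] is the one sought. *)
Lemma tau_cover t : exists n : int, tau n <= t < tau (n + 1).
Proof.
have T0 := period_gt0.
have archi (x : R) : exists k : nat, x < T *+ k.
  have := archi_boundP (normr_ge0 (x / T)); set k := Num.bound _ => kT.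
  exists k; rewrite -mulr_natr mulrC -ltr_pdivrMr //.
  exact: le_lt_trans (ler_norm _) kT.
have [n0 tn0] : exists n, tau n <= t.
  have [k kT] := archi (tau 0 - t); exists (- (b * k)%N%:Z).
  by have := tau_bX (- (b * k)%N%:Z) k; rewrite addNr; lra.
have ex : exists k : nat, t < tau (n0 + k%:Z + 1).
  have [k kT] := archi (t - tau n0); exists (b * k)%N; have := tau_bX n0 k.
  have : tau (n0 + (b * k)%N%:Z) < tau (n0 + (b * k)%N%:Z + 1) by rewrite tau_lt ltzD1.
  lra.
have [k tk kmin] := ex_minnP ex.
exists (n0 + k%:Z); rewrite tk andbT.
case: k kmin {tk} => [|k] kmin; first by rewrite addr0.
rewrite leNgt; apply/negP => tk; have := kmin k; rewrite ltnn.
by rewrite -addrA -[1]/(1%:Z) -PoszD addn1 => /(_ tk).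
Qed.

(** By mirror symmetry particles 1 and 2 suffice. On the cell containing [t] and on its translate by
    [T], the explicit motion starts from equal data, by [collision12_state]. *)
Lemma mirror_periodic i :
  [/\ periodic (pos h i) T, periodic (en h i) T & periodic (mom h i) T].
Proof.
have T0 := period_gt0.
suff H t : [/\ x1 (t + T) = x1 t, E1 (t + T) = E1 t & P1 (t + T) = P1 t] /\
    [/\ x2 (t + T) = x2 t, E2 (t + T) = E2 t & P2 (t + T) = P2 t].
  have per1 : [/\ periodic x1 T, periodic E1 T & periodic P1 T].
    by split=> t; have [[]] := H t.
  have per2 : [/\ periodic x2 T, periodic E2 T & periodic P2 T].
    by split=> t; have [_ []] := H t.
  have per_rev j : [/\ periodic (pos h j) T, periodic (en h j) T & periodic (mom h j) T] ->
      [/\ periodic (pos h (rev_ord j)) T, periodic (en h (rev_ord j)) T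
        & periodic (mom h (rev_ord j)) T].
    move=> [pj ej mj]; split=> t.
    - by rewrite !(mirror_pos hm) pj.
    - by rewrite !(mirror_en hm) ej.
    - by rewrite !(mirror_mom hm) mj.
  case: i => [[|[|[|[|//]]]] i4].
  - by rewrite (_ : Ordinal i4 = particle1) //; exact: val_inj.
  - by rewrite (_ : Ordinal i4 = particle2) //; exact: val_inj.
  - rewrite (_ : Ordinal i4 = rev_ord particle2); [exact: per_rev|exact: val_inj].
  - rewrite (_ : Ordinal i4 = rev_ord particle1); [exact: per_rev|exact: val_inj].
have [n tn] := tau_cover t.
have x12 := tau_collision n; have x12b := tau_collision (n + b%:Z).
have [E1b P1b E2b x1b] := collision12_state _ _ x12b x12 (sigma_b n).
have tbn : tau (n + b%:Z) <= t + T < tau (n + b%:Z + 1).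
  by rewrite addrAC !tau_b; lra.
have [E1t P1t E2t] := free_energies (tau_free n) _ tn.
have [E1t' P1t' E2t'] := free_energies (tau_free _) _ tbn.
have x1t := free_pos1 (tau_free n) _ tn.
have x1t' := free_pos1 (tau_free _) _ tbn.
have [x2t P2t] := free_state2 x12 (tau_free n) _ tn (vel2_collision12 _ x12).
have [x2t' P2t'] := free_state2 x12b (tau_free _) _ tbn (vel2_collision12 _ x12b).
have dT : t + T - tau (n + b%:Z) = t - tau n by rewrite tau_b; ring.
rewrite dT x1b in x1t' x2t' P2t'.
rewrite E1t E1t' P1t P1t' E2t E2t' x1t x1t' x2t x2t' P2t P2t' E1b P1b E2b.
by rewrite /vel E1b P1b.
Qed.

End Period.
End CollisionTimes.
End MirrorSolution.

(** * Boundedness and the value of the period *)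

Theorem theorem17 (R : realType) (mu calE : R) (hmu : 0 < mu)
    (hDelta : Delta mu calE < 0) :
  (forall h : history R 4, mirror_solution mu h -> mirror_energy h = calE ->
     forall i : 'I_4, bounded_set (range (pos h i)))
  /\
  (forall (d : R[i]) (theta : R) (a b : nat),
     d ^+ 2 = ((Delta mu calE)%:C)%C ->
     expi theta = sigma_at calE d / sigma_re calE d ->
     (0 < a)%N -> (0 < b)%N -> coprime a b ->
     theta = a%:R / b%:R * (2 * pi) ->
     forall h : history R 4, mirror_solution mu h -> mirror_energy h = calE ->
     forall tau : int -> R, collision_times12 h tau ->
     let k := pos h particle1 (tau 0) * en h particle2 (tau 0)
              / sigma h particle1 (tau 0) in
     let T := 2 * k * b%:R * mu / (mu - calE ^+ 2) in
     forall i : 'I_4,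
       [/\ periodic (pos h i) T, periodic (en h i) T & periodic (mom h i) T]).
Proof.
split=> [h hm hE|d theta a b d2 lE _ b0 _ thetaE h hm hE tau htau k T i].
  by apply: (mirror_bounded hmu hm); rewrite hE -subr_lt0.
have mu0 : mu != 0 by rewrite gt_eqF.
have kE : pair_product (h := h) 0 = k * mu.
  rewrite -(pair_product_collision12 hmu hm (tau 0)); last exact: (tau_collision hmu hm htau).
  rewrite /k -(sigma1_rho1 hm (tau 0)); field.
  by apply: contraNneq mu0 => s0; rewrite -(sigma1_rho1 hm (tau 0)) s0 mul0r.
(* Here [c = -2 * pair_product 0 / mu = -2 * k]. The sum does not depend on the starting index [n],
   so every stretch of [b] collisions lasts equally long. *)
have orbit n : sigma h particle1 (tau (n + b%:Z)) = sigma h particle1 (tau n) /\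
    \sum_(m < b) pos h particle1 (tau (n + m%:Z)) = k * b%:R * mu / Delta mu calE.
  have [m|m|] := elliptic_orbit_sum mu calE (- (2 * pair_product (h := h) 0 / mu))
    theta d a b (fun m => sigma h particle1 (tau (n + m%:Z)))
    (fun m => pos h particle1 (tau (n + m%:Z))) hDelta hmu d2 lE b0 thetaE.
  - have -> : n + m.+1%:Z = n + m%:Z + 1 by rewrite -addn1 PoszD addrA.
    rewrite -hE; apply: (sigma1_step hmu hm).
    + exact: (tau_collision hmu hm htau).
    + exact: (tau_collision hmu hm htau).
    + by rewrite (tau_lt htau) ltzD1.
    + exact: (tau_free hmu hm htau).
  - by rewrite -hE; apply: (pos1_collision12 hmu hm); exact: (tau_collision hmu hm htau).
  rewrite addr0 => -> ->; split=> //; rewrite kE; field.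
  by rewrite lt_eqF.
apply: (mirror_periodic hmu hm htau b0) => n; have [sb sumE] := orbit n => //.
rewrite (tau_sum hmu hm htau) sumE.
(* Equal [sigma1] forces equal [x1], so the endpoint terms of [tau_sum] cancel and the elapsed time
   is [-2] times the sum of positions. *)
have [_ _ _ ->] := collision12_state hmu hm _ _ (tau_collision hmu hm htau _)
  (tau_collision hmu hm htau _) sb.
rewrite addrK /T (_ : mu - calE ^+ 2 = - Delta mu calE); last by rewrite /Delta; ring.
by field; rewrite lt_eqF.
Qed.
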